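(* Let $n\ge 1$ be an integer and $\epsilon\in[0,1]$. Let $A_n(\epsilon)$ (respectively $B_n(\epsilon)$) be the maximum probability with which a dishonest Alice (respectively a dishonest Bob) can force an outcome of her (his) choice in the protocol $\mathcal{P}_n$ with parameter $\epsilon$, when the other party is honest. Then $$A_n(\epsilon)\ \ge\ \frac{1}{2(2-\epsilon)}\left(3-2\epsilon+(1-\epsilon)^{n+1}\right)\quad\text{if } n \text{ is odd},$$ $$A_n(\epsilon)\ \ge\ \frac{1}{2(2-\epsilon)}\left(3-2\epsilon-(1-\epsilon)^{n+1}\right)\quad\text{if } n \text{ is even},$$ and, for all $n$, $$B_n(\epsilon)\ \ge\ \frac{1}{2(2-\epsilon)}\left(3-\epsilon+(-1)^n(1-\epsilon)^{n+1}\right).$$ Consequently $A_n(\epsilon)+B_n(\epsilon)\ge 3/2$, so that $\max\{A_n(\epsilon),B_n(\epsilon)\}\ge 3/4$; i.e. the bias of $\mathcal{P}_n$ is at least $1/4$ for every $n$ and $\epsilon$.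
   Context: For $x,s\in\{0,1\}$ and $\epsilon\in[0,1]$, define the qutrit state (in the orthonormal basis $|0\rangle,|1\rangle,|2\rangle$) $$|\psi(x,s)\rangle=\sqrt{1-\epsilon}\,|0\rangle+(-1)^s\sqrt{\epsilon}\,|x+1\rangle .$$ The protocol $\mathcal{P}_n$ between honest Alice and Bob is as follows. Alice picks $a\in\{0,1\}$ and Bob picks $b\in\{0,1\}$, uniformly and independently at random. 1. For $i=1,2,\ldots,n$ in this order: if $i$ is odd, Alice picks a uniformly random (independent) $s_i\in\{0,1\}$ and sends $|\psi(a,s_i)\rangle$ to Bob; if $i$ is even, Bob picks a uniformly random (independent) $s_i\in\{0,1\}$ and sends $|\psi(b,s_i)\rangle$ to Alice. 2. If $n$ is even, Alice sends $a$ to Bob and then Bob sends $b$ to Alice. If $n$ is odd, Bob sends $b$ to Alice and then Alice sends $a$ to Bob. 3. For $i=n,n-1,\ldots,1$ in this order, the player who picked $s_i$ sends it to the other player (Alice if $i$ is odd, Bob if $i$ is even). The player receiving $s_i$ checks the qutrit received in the $i$-th round of step 1 by the projective measurement testing whether it is in the state $|\psi(x,s_i)\rangle$, where $x$ is the bit that the other player sent in step 2. 4. If all checks are passed, the outcome of the protocol is $c=a\oplus b$. A dishonest player may apply arbitrary quantum operations to private workspace and to all systems received so far, sending messages of the prescribed type at the prescribed times. ''Forcing outcome $v$'' means that the honest player's checks all pass and the honest player obtains $c=v$. The bias of the protocol is the smallest $\delta$ such that, when one player is honest, for every strategy of the other player and every $v\in\{0,1\}$ the outcome is $v$ with probability at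 most $1/2+\delta$. *)

(* Defs.v *)
From HB Require Import structures.
From mathcomp Require Import all_boot all_order all_algebra.
From mathcomp Require Import spectral complex mxtens.
From mathcomp Require Import boolp classical_sets reals.

Set Implicit Arguments.
Unset Strict Implicit.
Unset Printing Implicit Defensive.

Import Order.TTheory GRing.Theory Num.Theory.

Local Open Scope ring_scope.
Local Open Scope complex_scope.
Local Open Scope sesquilinear_scope.
Local Open Scope classical_set_scope.

(* A state of a d-dimensional system is a (possibly subnormalised) density    *)
(* matrix of type 'M[R[i]]_d; kets are column vectors, and an operator K acts *)
(* on a state r by K r K^* (K^* the adjoint, written K ^t* ).                 *)

Definition ket {R : realType} (k : nat) : 'cV[R[i]]_3 := delta_mx (inord k) 0.

Definition psi {R : realType} (eps : R) (x s : bool) : 'cV[R[i]]_3 :=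
  (Num.sqrt (1 - eps))%:C *: ket 0
  + ((-1) ^+ s * (Num.sqrt eps)%:C) *: ket x.+1.

Inductive player := Alice | Bob.

(* Whether player p is the sender in the i-th round, i = 1, 2, ... *)
Definition sends (p : player) (i : nat) : bool :=
  if p is Alice then odd i else ~~ odd i.

(* A quantum instrument, from dimension w to dimension w', with classical     *)
(* outcome in T and Kraus operators (kraus t j)_j for the outcome t.  With T  *)
(* = unit this is a quantum operation, i.e. a completely positive             *)
(* trace-preserving map.                                                      *)
Record instrument (R : realType) (T : finType) (w w' : nat) := Instrument {
  kraus_num : nat;
  kraus : T -> 'I_kraus_num -> 'M[R[i]]_(w', w);
  kraus_tp : \sum_t \sum_j (kraus t j) ^t* *m kraus t j = 1%:M
}.
Arguments kraus {R T w w'} i t j : rename.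

(* The strategies of a dishonest player p.  w is the current dimension of     *)
(* everything p holds: private workspace and all qutrits received so far.  A  *)
(* quantum operation, with arbitrary output dimension, takes place whenever p *)
(* has to send a message; operations performed between two messages of p can  *)
(* be merged into the next such operation.  After a classical message, sent   *)
(* or received, the rest of the strategy may depend on its value.             *)

(* Step 3, when the bits s_i, ..., s_1 remain to be sent. *)
Fixpoint reveal_strategy (R : realType) (p : player) (i w : nat) : Type :=
  if i is i'.+1 then
    if sends p i'.+1 then
      {w' : nat & (instrument R bool w w' *
                   (bool -> reveal_strategy R p i' w'))%type}
    else bool -> reveal_strategy R p i' w
  else unit.

(* Step 2 in the n-round protocol.  Alice announces her bit first if and only *)
(* if n is even, that is, the first to announce would be the sender of an     *)
(* (n+1)-st round.                                                            *)
Definition announce_strategy (R : realType) (p : player) (n w : nat) : Type :=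
  if sends p n.+1 then
    {w' : nat & (instrument R bool w w' *
                 (bool -> bool -> reveal_strategy R p n w'))%type}
  else
    bool -> {w' : nat & (instrument R bool w w' *
                         (bool -> reveal_strategy R p n w'))%type}.

(* Step 1, when i rounds are over and m more are to be played. *)
Fixpoint commit_strategy (R : realType) (p : player) (m i w : nat) : Type :=
  if m is m'.+1 then
    if sends p i.+1 then
      {w' : nat & (instrument R unit w (w' * 3) *
                   commit_strategy R p m' i.+1 w')%type}
    else commit_strategy R p m' i.+1 (w * 3)
  else announce_strategy R p i w.

(* The initial one-dimensional workspace is no restriction, as operations may *)
(* introduce fresh systems.                                                   *)
Definition strategy (R : realType) (p : player) (n : nat) : Type :=
  commit_strategy R p n 0 1.

(* Number of qutrits sent by p in rounds 1, ..., i. *)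
Fixpoint held (p : player) (i : nat) : nat :=
  if i is i'.+1 then
    if sends p i'.+1 then (held p i').+1 else held p i'
  else 0.

(* The joint system when the dishonest player holds a w-dimensional system    *)
(* and the honest player holds k unchecked qutrits is                         *)
(*   C^w (x) C^3 (x) ... (x) C^3,                                             *)
(* the qutrits being in the order last received, ..., first received.  Since  *)
(* joint w k.+1 is convertible to joint (w * 3) k, a qutrit changes hands     *)
(* without any reindexing.                                                    *)
Fixpoint joint (w k : nat) : nat :=
  if k is k'.+1 then joint (w * 3) k' else w.

(* K (x) 1 (x) ... (x) 1 *)
Fixpoint lift_op {R : realType} (w w' k : nat) :
    'M[R[i]]_(w', w) -> 'M[R[i]]_(joint w' k, joint w k) :=
  match k return 'M[R[i]]_(w', w) -> 'M[R[i]]_(joint w' k, joint w k) with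
  | 0 => fun K => K
  | k'.+1 => fun K => lift_op k' (tensmx K (1%:M : 'M[R[i]]_3))
  end.

Definition apply_op {R : realType} (d d' : nat) (K : 'M[R[i]]_(d', d))
    (r : 'M[R[i]]_d) : 'M[R[i]]_d' :=
  K *m r *m K ^t*.

Definition apply_instrument {R : realType} (T : finType) (w w' k : nat)
    (E : instrument R T w w') (t : T) (r : 'M[R[i]]_(joint w k)) :
    'M[R[i]]_(joint w' k) :=
  \sum_j apply_op (lift_op k (kraus E t j)) r.

(* The isometry u |-> u (x) v, for a unit vector v. *)
Definition adjoin {R : realType} (w : nat) (v : 'cV[R[i]]_3) :
    'M[R[i]]_(w * 3, w) :=
  \matrix_(i, j) (((mxtens_unindex i).1 == j)%:R * v (mxtens_unindex i).2 0).

Definition receive {R : realType} (w k : nat) (v : 'cV[R[i]]_3)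
    (r : 'M[R[i]]_(joint w k)) : 'M[R[i]]_(joint (w * 3) k) :=
  apply_op (lift_op k (adjoin w v)) r.

(* The honest player measures {|v><v|, 1 - |v><v|} on the last qutrit not yet *)
(* checked.  The result is the unnormalised state in the case where the check *)
(* is passed, without the measured qutrit, which is then in state v and is    *)
(* not used any more.                                                         *)
Definition check {R : realType} (w k : nat) (v : 'cV[R[i]]_3)
    (r : 'M[R[i]]_(joint w k.+1)) : 'M[R[i]]_(joint w k) :=
  apply_op (lift_op k ((adjoin w v) ^t*)) r.

(* The run_* functions return the probability that all the checks still to be *)
(* made by the honest player are passed and that the outcome is v, starting   *)
(* from the joint state r.  Here x is the bit picked by the honest player, y  *)
(* the bit announced by the dishonest one, and nth false s i.-1 is the bit    *)
(* s_i, used if the honest player is the sender in round i.                   *)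

Fixpoint run_reveal {R : realType} (eps : R) (p : player) (x y v : bool)
    (s : seq bool) (i w : nat) :
    reveal_strategy R p i w -> 'M[R[i]]_(joint w (held p i)) -> R :=
  match i return
    reveal_strategy R p i w -> 'M[R[i]]_(joint w (held p i)) -> R with
  | 0 => fun _ r => if x (+) y == v then complex.Re (\tr r) else 0
  | i'.+1 =>
    match sends p i'.+1 as b return
      (if b then {w' : nat & (instrument R bool w w' *
                              (bool -> reveal_strategy R p i' w'))%type}
       else bool -> reveal_strategy R p i' w) ->
      'M[R[i]]_(joint w (if b then (held p i').+1 else held p i')) -> R with
    | true => fun S r =>
        let: existT _ (E, S') := S in
        \sum_(t : bool) run_reveal eps x y v s (S' t)
          (check (psi eps y t)
             (apply_instrument (k := (held p i').+1) E t r))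
    | false => fun S r => run_reveal eps x y v s (S (nth false s i')) r
    end
  end.

Definition run_announce {R : realType} (eps : R) (p : player) (x v : bool)
    (s : seq bool) (n w : nat) :
    announce_strategy R p n w -> 'M[R[i]]_(joint w (held p n)) -> R :=
  match sends p n.+1 as b return
    (if b then {w' : nat & (instrument R bool w w' *
                            (bool -> bool -> reveal_strategy R p n w'))%type}
     else bool -> {w' : nat & (instrument R bool w w' *
                               (bool -> reveal_strategy R p n w'))%type}) ->
    'M[R[i]]_(joint w (held p n)) -> R with
  | true => fun S r =>
      let: existT _ (E, S') := S in
      \sum_(y : bool) run_reveal eps x y v s (S' y x) (apply_instrument E y r)
  | false => fun S r =>
      let: existT _ (E, S') := S x in
      \sum_(y : bool) run_reveal eps x y v s (S' y) (apply_instrument E y r)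
  end.

(* The second argument of the inner match is the recursive call, with the     *)
(* number of qutrits held after round i + 1 exposed.                          *)
Fixpoint run_commit {R : realType} (eps : R) (p : player) (x v : bool)
    (s : seq bool) (m i w : nat) :
    commit_strategy R p m i w -> 'M[R[i]]_(joint w (held p i)) -> R :=
  match m return
    commit_strategy R p m i w -> 'M[R[i]]_(joint w (held p i)) -> R with
  | 0 => fun S r => run_announce eps x v s S r
  | m'.+1 => fun S r =>
    match sends p i.+1 as b return
      (if b then {w' : nat & (instrument R unit w (w' * 3) *
                              commit_strategy R p m' i.+1 w')%type}
       else commit_strategy R p m' i.+1 (w * 3)) ->
      (forall w' : nat, commit_strategy R p m' i.+1 w' ->
         'M[R[i]]_(joint w' (if b then (held p i).+1 else held p i)) -> R) ->
      R with
    | true => fun S run =>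
        let: existT w' (E, S') := S in run w' S' (apply_instrument E tt r)
    | false => fun S run =>
        run (w * 3)%N S (receive (psi eps x (nth false s i)) r)
    end S (fun w' S' r' => run_commit eps x v s S' r')
  end.

(* The honest player's bits are uniform and independent. *)
Definition forcing_probability {R : realType} (eps : R) (p : player) (n : nat)
    (S : strategy R p n) (v : bool) : R :=
  2^-1 * \sum_(x : bool) (2 ^+ n)^-1 *
    \sum_(s : n.-tuple bool) run_commit eps x v s S (1%:M : 'M_(joint 1 0)).

(* The maximum over all strategies and target outcomes, written as a          *)
(* supremum so that the definition does not presuppose that it is attained.   *)
Definition max_forcing {R : realType} (p : player) (n : nat) (eps : R) : R :=
  sup [set q | exists (S : strategy R p n) (v : bool),
                 q = forcing_probability eps S v].

(* The smallest such delta: the set is nonempty, closed and bounded below. *)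
Definition bias {R : realType} (n : nat) (eps : R) : R :=
  inf [set delta | forall (p : player) (S : strategy R p n) (v : bool),
                     forcing_probability eps S v <= 2^-1 + delta].

(* Main.v *)
From HB Require Import structures.
Require Import Defs.
From mathcomp Require Import all_boot all_order all_algebra.
From mathcomp Require Import spectral complex mxtens.
From mathcomp Require Import boolp classical_sets reals.
From mathcomp Require Import ring lra.
Import Order.TTheory GRing.Theory Num.Theory.
Local Open Scope ring_scope.
Local Open Scope complex_scope.
Local Open Scope sesquilinear_scope.

Set Implicit Arguments.
Unset Strict Implicit.
Unset Printing Implicit Defensive.

(* The cheater stays undecided as long as every qutrit received or sent is in *)
(* the state |0>.  A received qutrit in a state |a+1> reveals the honest bit  *)
(* a; when sending, an undecided cheater prepares a superposition of |0>      *)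
(* (still undecided), |1> and |2> (guessing a = 0 or a = 1), and a decided    *)
(* one plays honestly with the bit decided upon.  Everything is kept          *)
(* coherent, in copies of the qutrits.  In the last phase, undoing the rounds *)
(* from n down to 1 rotates the amplitudes of the undecided and the decided   *)
(* branches onto each other.  If W i is the probability of winning for a      *)
(* cheater undecided after i rounds, then, for the best amplitudes,           *)
(*   W i = eps t + (1 - eps) W (i + 1),                                       *)
(* where t = 1/2 if the cheater sends in round i + 1 and t = 1 otherwise; W n *)
(* is 1/2 or 1 according to who announces first.  Solving this recurrence     *)
(* gives the two bounds, whose sum is exactly 3/2.                            *)

(** The cheater aims at [c = 0]: the announced bit must equal the honest bit [x] and all checks must
    pass.

    The commit phase leads to the vector [commit_state]. Undoing one round in the reveal phase turns
    the weights [rho x i.+1] into [rho x i] ([reveal_meas_send], [reveal_recv]). Undecided branches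
    have weight the square root of [W i]; the amplitudes are the Cauchy-Schwarz optimal ones, and
    the recurrence for [W] is exactly their normalisation. With no round left every branch is
    undecided and the squared norm is [W 0] ([reveal_strategy_exists], [forcing_probability_ge]).

    The solution [value_closed] of the recurrence deviates from 3/4 by an amount whose sign depends
    only on who sends in round 1. The deviations of Alice and Bob cancel, so their values sum to
    3/2, and the two can be at most 1/2 + delta only if delta is at least 1/4. *)

Section Adjoint.

(** * Adjoints and operators lifted to the joint system *)

Context {R : realType}.
Implicit Types m n p : nat.

Lemma adjmxM m n p (A : 'M[R[i]]_(m, n)) (B : 'M[R[i]]_(n, p)) :
  (A *m B) ^t* = B ^t* *m A ^t*.
Proof. by rewrite trmx_mul map_mxM. Qed.

Lemma adjmxB m n (A B : 'M[R[i]]_(m, n)) : (A - B) ^t* = A ^t* - B ^t*.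
Proof. by rewrite linearB map_mxB. Qed.

Lemma adjmx1 n : (1%:M : 'M[R[i]]_n) ^t* = 1%:M.
Proof. by rewrite trmx1 map_mx1. Qed.

Lemma adjmxZ m n (c : R[i]) (A : 'M[R[i]]_(m, n)) :
  (c *: A) ^t* = (c^*) *: A ^t*.
Proof. by rewrite linearZ map_mxZ. Qed.

Lemma adjmx_tens m n p q (A : 'M[R[i]]_(m, n)) (B : 'M[R[i]]_(p, q)) :
  (tensmx A B) ^t* = tensmx (A ^t*) (B ^t*).
Proof. by rewrite trmx_tens map_mxT. Qed.

Lemma lift_opM w1 w2 w3 k (A : 'M[R[i]]_(w1, w2)) (B : 'M[R[i]]_(w2, w3)) :
  lift_op k (A *m B) = lift_op k A *m lift_op k B.
Proof.
elim: k w1 w2 w3 A B => [//|k IH] w1 w2 w3 A B /=.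
by rewrite -IH tensmx_mul mulmx1.
Qed.

Lemma lift_op_linear w1 w2 k c (A B : 'M[R[i]]_(w1, w2)) :
  lift_op k (c *: A + B) = c *: lift_op k A + lift_op k B.
Proof.
elim: k w1 w2 A B => [//|k IH] w1 w2 A B /=.
rewrite -IH; congr lift_op; apply/matrixP => u v.
by rewrite !mxE mulrDl mulrA.
Qed.

HB.instance Definition _ w1 w2 k :=
  GRing.isLinear.Build R[i] 'M[R[i]]_(w1, w2) 'M[R[i]]_(joint w1 k, joint w2 k)
    *:%R (@lift_op R w2 w1 k) (@lift_op_linear w1 w2 k).

Lemma lift_op_adj w1 w2 k (A : 'M[R[i]]_(w1, w2)) :
  lift_op k (A ^t*) = (lift_op k A) ^t*.
Proof.
elim: k w1 w2 A => [//|k IH] w1 w2 A /=.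
by rewrite -IH adjmx_tens adjmx1.
Qed.

Lemma lift_op1 w k : lift_op k (1%:M : 'M[R[i]]_w) = 1%:M.
Proof.
elim: k w => [//|k IH] w /=.
rewrite -[RHS](IH (w * 3)%N); congr lift_op; apply/matrixP => u v.
by rewrite !mxE -natrM mulnb -xpair_eqE -!surjective_pairing
  (can_eq (@mxtens_unindexK _ _)).
Qed.

Lemma sum_mxtens (V : nmodType) w (F : 'I_(w * 3) -> V) :
  \sum_u F u = \sum_m \sum_j F (mxtens_index (m, j)).
Proof.
rewrite pair_bigA (reindex (@mxtens_index w 3)) /=; last first.
  by exists (@mxtens_unindex w 3) => ? _;
    rewrite ?mxtens_indexK ?mxtens_unindexK.
by apply: eq_bigr => -[].
Qed.

Lemma mulmx_tens_adjoin w w' (A : 'M[R[i]]_(w', w)) (v : 'cV[R[i]]_3) :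
  tensmx A 1%:M *m adjoin w v = adjoin w' v *m A.
Proof.
apply/matrixP => u m; case: (mxtens_indexP u) => a b.
rewrite !mxE sum_mxtens.
rewrite (bigD1 m) //= [X in _ + X]big1 ?addr0; last first.
  move=> j jm; apply: big1 => k _.
  by rewrite !mxE !mxtens_indexK /= (negbTE jm) mul0r mulr0.
rewrite (bigD1 b) //= [X in _ + X]big1 ?addr0; last first.
  by move=> k kb; rewrite !mxE !mxtens_indexK /= eq_sym (negbTE kb) mulr0 mul0r.
rewrite [RHS](bigD1 a) //= [X in _ = _ + X]big1 ?addr0; last first.
  by move=> k ka; rewrite !mxE !mxtens_indexK /= eq_sym (negbTE ka) !mul0r.
by rewrite !mxE !mxtens_indexK /= !eqxx !mul1r mulr1 mulrC.
Qed.

End Adjoint.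

(** * Operators controlled by a memory basis state, and completion of instruments *)

Section Blocks.
Context {R : realType}.

(** The memory basis state [m] is a control: [rowop] applies the bra [l m] to the last qutrit,
    [colop] creates a qutrit with amplitudes [c m], and [diagop] multiplies by [g m]. *)
Definition rowop w (l : 'I_w -> 'I_3 -> R) : 'M[R[i]]_(w, w * 3) :=
  \matrix_(m, u) (((mxtens_unindex u).1 == m)%:R * l m (mxtens_unindex u).2)%:C.

Definition colop w (c : 'I_w -> 'I_3 -> R) : 'M[R[i]]_(w * 3, w) :=
  \matrix_(u, m) (((mxtens_unindex u).1 == m)%:R * c m (mxtens_unindex u).2)%:C.

Definition diagop w (g : 'I_w -> R) : 'M[R[i]]_w :=
  \matrix_(m, m') ((m == m')%:R * g m)%:C.

Lemma conjC_real (x : R) : Num.conj (x%:C) = x%:C.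
Proof. by apply: conj_Creal; apply/complex_realP; exists x. Qed.

Lemma rowop_adj w (l : 'I_w -> 'I_3 -> R) : (rowop l) ^t* = colop l.
Proof. by apply/matrixP => u m; rewrite !mxE conjC_real. Qed.

Lemma colop_adj w (l : 'I_w -> 'I_3 -> R) : (colop l) ^t* = rowop l.
Proof. by apply/matrixP => u m; rewrite !mxE conjC_real. Qed.

Lemma diagop_adj w (g : 'I_w -> R) : (diagop g) ^t* = diagop g.
Proof.
apply/matrixP => u m; rewrite !mxE conjC_real eq_sym.
by case: eqP => [->//|_]; rewrite !mul0r.
Qed.

Lemma diagop1 w (g : 'I_w -> R) : (forall m, g m = 1) -> diagop g = 1%:M.
Proof. by move=> h; apply/matrixP => u m; rewrite !mxE h mulr1 rmorph_nat. Qed.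

Lemma diagopD w (g h : 'I_w -> R) :
  diagop g + diagop h = diagop (fun m => g m + h m).
Proof. by apply/matrixP => u m; rewrite !mxE -rmorphD mulrDr. Qed.

Lemma mul_diagop w (g h : 'I_w -> R) :
  diagop g *m diagop h = diagop (fun m => g m * h m).
Proof.
apply/matrixP => u m; rewrite !mxE (bigD1 u) //= big1 ?addr0; last first.
  by move=> k ku; rewrite !mxE eq_sym (negbTE ku) !mul0r.
rewrite !mxE -rmorphM eqxx mul1r; case: eqP => [->|_]; first by rewrite !mul1r.
by rewrite !mul0r mulr0.
Qed.

Lemma mul_rowop_colop w (l c : 'I_w -> 'I_3 -> R) :
  rowop l *m colop c = diagop (fun m => \sum_j l m j * c m j).
Proof.
apply/matrixP => m m'; rewrite !mxE sum_mxtens (bigD1 m) //=.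
rewrite [X in _ + X]big1 ?addr0; last first.
  move=> k km; apply: big1 => j _.
  by rewrite !mxE !mxtens_indexK /= (negbTE km) !mul0r.
rewrite mulr_sumr rmorph_sum; apply: eq_bigr => j _.
rewrite !mxE !mxtens_indexK /= -rmorphM eqxx mul1r.
by case: eqP => [->|_]; rewrite ?mul1r // !mul0r mulr0.
Qed.

Lemma mul_diagop_colop w (g : 'I_(w * 3) -> R) (c : 'I_w -> 'I_3 -> R) :
  diagop g *m colop c = colop (fun m j => g (mxtens_index (m, j)) * c m j).
Proof.
apply/matrixP => u m; case: (mxtens_indexP u) => a b.
rewrite !mxE !mxtens_indexK /= (bigD1 (mxtens_index (a, b))) //=.
rewrite big1 ?addr0; last first.
  by move=> k ku; rewrite !mxE eq_sym (negbTE ku) !mul0r.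
rewrite !mxE !mxtens_indexK /= -rmorphM eqxx mul1r.
by case: eqP => [->|_]; [rewrite !mul1r | rewrite !mul0r mulr0].
Qed.

Lemma adjoin_colop w (v : 'I_3 -> R) :
  adjoin w (\col_j (v j)%:C) = colop (fun _ => v).
Proof. by apply/matrixP => u m; rewrite !mxE rmorphM rmorph_nat. Qed.

Lemma tens_diagop w (g : 'I_w -> R) :
  tensmx (diagop g) 1%:M = diagop (fun u => g (@mxtens_unindex w 3 u).1).
Proof.
apply/matrixP => u v; case: (mxtens_indexP u) => a b.
case: (mxtens_indexP v) => a' b'.
rewrite tensmxE !mxE !mxtens_indexK /= (can_eq (@mxtens_indexK _ _)) xpair_eqE.
by do 2!case: eqP => _; rewrite /= ?(mul1r, mul0r, mulr1, mulr0).
Qed.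

Lemma mul_colop_rowop w (c l : 'I_w -> 'I_3 -> R) a b a' b' :
  (colop c *m rowop l) (mxtens_index (a, b)) (mxtens_index (a', b'))
  = ((a == a')%:R * (c a b * l a b'))%:C.
Proof.
rewrite !mxE (bigD1 a) //= big1 ?addr0; last first.
  by move=> k ka; rewrite !mxE !mxtens_indexK /= eq_sym (negbTE ka) !mul0r.
rewrite !mxE !mxtens_indexK /= eqxx mul1r -rmorphM.
by rewrite mulrCA (eq_sym a').
Qed.

(** Each row of [C] becomes a Kraus operator with image in the line of one fixed basis vector,
    attached to the outcome [t0]; their squares sum to [C ^t* *m C]. Unwanted branches are thus
    absorbed, whatever their dimension. *)
Lemma instrument_completion (T : finType) (t0 : T) w w' k
    (M : T -> 'M[R[i]]_(w', w)) (C : 'M[R[i]]_(k, w)) :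
  (0 < w')%N -> \sum_t (M t) ^t* *m M t + C ^t* *m C = 1%:M ->
  exists E : instrument R T w w', forall t, exists j, kraus E t j = M t.
Proof.
move=> w0 h; pose o := Ordinal w0.
pose K (t : T) (j : 'I_k.+1) : 'M[R[i]]_(w', w) :=
  if unlift ord0 j is Some j' then
    if t == t0 then (delta_mx o 0 : 'cV_w') *m row j' C else 0
  else M t.
have hK : \sum_t \sum_j (K t j) ^t* *m K t j = 1%:M.
  rewrite -h; under eq_bigr => t _ do rewrite big_ord_recl.
  rewrite big_split /=; congr (_ + _).
    by apply: eq_bigr => t _; rewrite /K unlift_none.
  rewrite (bigD1 t0) //= [X in _ + X]big1 ?addr0; last first.
    move=> t tt0; apply: big1 => j _.
    by rewrite /K liftK (negbTE tt0) mulmx0.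
  apply/matrixP => u v; rewrite summxE !mxE; apply: eq_bigr => j _.
  rewrite /K liftK eqxx adjmxM mulmxA -(mulmxA _ _ (delta_mx o 0)).
  rewrite trmx_delta map_delta_mx mul_delta_mx.
  have -> : delta_mx 0 0 = 1%:M :> 'M[R[i]]_1.
    by apply/matrixP => a b; rewrite !mxE !ord1.
  by rewrite mulmx1 !mxE big_ord1 !mxE.
exists (Instrument hK) => t; exists ord0.
by rewrite /= /K unlift_none.
Qed.

End Blocks.

(** * Positive semidefinite states, domination and traces *)

Section Psd.
Context {R : realType}.

Definition psd d (r : 'M[R[i]]_d) :=
  exists k (B : 'M[R[i]]_(d, k)), r = B *m B ^t*.

(* [f f^* <= r] in the Loewner order. *)
Definition dominates d (r : 'M[R[i]]_d) (f : 'cV[R[i]]_d) :=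
  psd (r - f *m f ^t*).

Lemma psd_outer d k (B : 'M[R[i]]_(d, k)) : psd (B *m B ^t*).
Proof. by exists k, B. Qed.

Lemma psd0 d : psd (0 : 'M[R[i]]_d).
Proof. by exists 0, 0; rewrite mul0mx. Qed.

Lemma psdD d (r r' : 'M[R[i]]_d) : psd r -> psd r' -> psd (r + r').
Proof.
move=> [k [B ->]] [k' [B' ->]]; exists (k + k')%N, (row_mx B B').
by rewrite tr_row_mx map_col_mx mul_row_col.
Qed.

Lemma psd_sum d (I : Type) (s : seq I) (P : pred I) (F : I -> 'M[R[i]]_d) :
  (forall i, P i -> psd (F i)) -> psd (\sum_(i <- s | P i) F i).
Proof. by move=> h; apply: big_ind => //; [exact: psd0|exact: psdD]. Qed.

Lemma psd_apply_op d d' (K : 'M[R[i]]_(d', d)) (r : 'M[R[i]]_d) :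
  psd r -> psd (apply_op K r).
Proof.
move=> [k [B ->]]; exists k, (K *m B).
by rewrite /apply_op adjmxM !mulmxA.
Qed.

Lemma psd_apply_instrument (T : finType) w w' k (E : instrument R T w w') t
    (r : 'M[R[i]]_(joint w k)) : psd r -> psd (apply_instrument E t r).
Proof. by move=> hr; apply: psd_sum => j _; apply: psd_apply_op. Qed.

Lemma psd_tr_ge0 d (r : 'M[R[i]]_d) : psd r -> 0 <= complex.Re (\tr r).
Proof.
move=> [k [B ->]]; rewrite /mxtrace raddf_sum; apply: sumr_ge0 => i _.
rewrite mxE raddf_sum; apply: sumr_ge0 => j _; rewrite !mxE -normCK.
by rewrite -add_Re2_Im2 /= addr_ge0 ?sqr_ge0.
Qed.

Lemma dominates_psd d (r : 'M[R[i]]_d) f : dominates r f -> psd r.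
Proof. by move=> h; rewrite -(subrK (f *m f ^t*) r); apply/psdD/psd_outer. Qed.

Lemma dominates_outer d (f : 'cV[R[i]]_d) : dominates (f *m f ^t*) f.
Proof. by rewrite /dominates subrr; apply: psd0. Qed.

Lemma dominates_apply_op d d' (K : 'M[R[i]]_(d', d)) (r : 'M[R[i]]_d) f :
  dominates r f -> dominates (apply_op K r) (K *m f).
Proof.
move=> /(psd_apply_op K); rewrite /dominates /apply_op adjmxM.
by rewrite mulmxBr mulmxBl !mulmxA.
Qed.

Lemma dominates_apply_instrument (T : finType) w w' k (E : instrument R T w w')
    t (j : 'I_(kraus_num E)) (r : 'M[R[i]]_(joint w k)) f :
  dominates r f ->
  dominates (apply_instrument E t r) (lift_op k (kraus E t j) *m f).
Proof.
move=> h; rewrite /dominates /apply_instrument (bigD1 j) //= addrAC.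
apply: psdD; first exact: dominates_apply_op.
by apply: psd_sum => i _; apply: psd_apply_op; apply: dominates_psd h.
Qed.

Lemma tr_apply_lift w w' k (K : 'M[R[i]]_(w', w)) (r : 'M[R[i]]_(joint w k)) :
  \tr (apply_op (lift_op k K) r) = \tr (lift_op k (K ^t* *m K) *m r).
Proof. by rewrite /apply_op mxtrace_mulC mulmxA -lift_op_adj -lift_opM. Qed.

Lemma tr_apply_instrument (T : finType) w w' k (E : instrument R T w w')
    (r : 'M[R[i]]_(joint w k)) :
  \sum_t \tr (apply_instrument E t r) = \tr r.
Proof.
transitivity (\tr (lift_op k (\sum_t \sum_j (kraus E t j) ^t* *m kraus E t j)
  *m r)); last by rewrite kraus_tp lift_op1 mul1mx.
rewrite linear_sum mulmx_suml linear_sum; apply: eq_bigr => t _ /=.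
rewrite !linear_sum mulmx_suml linear_sum; apply: eq_bigr => j _ /=.
exact: tr_apply_lift.
Qed.

Lemma tr_apply_isometry w w' k (K : 'M[R[i]]_(w', w))
    (r : 'M[R[i]]_(joint w k)) :
  K ^t* *m K = 1%:M -> \tr (apply_op (lift_op k K) r) = \tr r.
Proof. by move=> h; rewrite tr_apply_lift h lift_op1 mul1mx. Qed.

(** [Z ^t* *m Z] is an orthogonal projector, hence so is its complement. *)
Lemma coisometry_complement m n (Z : 'M[R[i]]_(m, n)) :
  Z *m Z ^t* = 1%:M ->
  (1%:M - Z ^t* *m Z) ^t* *m (1%:M - Z ^t* *m Z) = 1%:M - Z ^t* *m Z.
Proof.
move=> h; rewrite adjmxB adjmx1 adjmxM trmxCK.
rewrite mulmxBl mul1mx mulmxBr mulmx1 mulmxA -(mulmxA (Z ^t*)) h mulmx1.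
by rewrite subrr subr0.
Qed.

Lemma tr_apply_coisometry w w' k (K : 'M[R[i]]_(w', w))
    (r : 'M[R[i]]_(joint w k)) : K *m K ^t* = 1%:M -> psd r ->
  complex.Re (\tr (apply_op (lift_op k K) r)) <= complex.Re (\tr r).
Proof.
move=> h hr; rewrite -subr_ge0.
have := psd_tr_ge0 (psd_apply_op (lift_op k (1%:M - K ^t* *m K)) hr).
rewrite tr_apply_lift coisometry_complement // linearB /= lift_op1.
by rewrite mulmxBl mul1mx linearB /= -tr_apply_lift raddfB.
Qed.

End Psd.

(** * Forcing probabilities are at most 1 *)

Section Upper.
Context {R : realType}.
Variables (eps : R) (heps : 0 <= eps <= 1).

Let q_ge0 : 0 <= 1 - eps.
Proof. by case/andP: heps => _ h; rewrite subr_ge0. Qed.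

Let eps_ge0 : 0 <= eps.
Proof. by case/andP: heps. Qed.

Definition psi_coef (x s : bool) (j : 'I_3) : R :=
  (j == 0)%:R * Num.sqrt (1 - eps)
  + (j == inord x.+1)%:R * ((-1) ^+ s * Num.sqrt eps).

Lemma sum_I3 (V : nmodType) (F : 'I_3 -> V) (x : bool) :
  \sum_j F j = F 0 + F (inord x.+1) + F (inord (~~ x).+1).
Proof.
rewrite !big_ord_recl big_ord0 addr0 addrA.
have -> : lift ord0 ord0 = inord 1 :> 'I_3 by apply/val_inj; rewrite /= inordK.
have -> : lift ord0 (lift ord0 ord0) = inord 2 :> 'I_3.
  by apply/val_inj; rewrite /= inordK.
by case: x => //; rewrite addrAC.
Qed.

Lemma inord3_neq0 (x : bool) : (inord x.+1 == 0 :> 'I_3) = false.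
Proof. by rewrite -val_eqE /= inordK //; case: x. Qed.

Lemma inord3_eq (x y : bool) :
  (inord x.+1 == inord y.+1 :> 'I_3) = (x == y).
Proof. by rewrite -val_eqE /= !inordK //; case: x; case: y. Qed.

Lemma psiE x s : psi eps x s = \col_j (psi_coef x s j)%:C.
Proof.
apply/matrixP => j k; rewrite !mxE ord1 eqxx !andbT.
have -> : inord 0 = 0 :> 'I_3 by apply/val_inj; rewrite /= inordK.
rewrite /psi_coef rmorphD !rmorphM !rmorph_nat rmorphXn rmorphN rmorph1.
by rewrite mulrC [in X in _ + X]mulrC.
Qed.

Lemma sum_psi_coef x s : \sum_j psi_coef x s j * psi_coef x s j = 1.
Proof.
rewrite (sum_I3 _ x) /psi_coef !eqxx !inord3_neq0 !(eq_sym 0) !inord3_neq0.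
rewrite !inord3_eq; have -> : (~~ x == x) = false by case: x.
rewrite !mul1r !mul0r !addr0 !add0r mulr0 addr0 mulrACA -!expr2.
by rewrite -exprM mulnC exprM sqrrN !expr1n mul1r !sqr_sqrtr ?subrK.
Qed.

Lemma adjoin_psi_isometry w x s :
  (adjoin w (psi eps x s)) ^t* *m adjoin w (psi eps x s) = 1%:M.
Proof.
by rewrite psiE adjoin_colop colop_adj mul_rowop_colop diagop1 // => _;
  apply: sum_psi_coef.
Qed.

Lemma psd_receive w k x s (r : 'M[R[i]]_(joint w k)) :
  psd r -> psd (receive (psi eps x s) r).
Proof. exact: psd_apply_op. Qed.

Lemma psd_check w k x s (r : 'M[R[i]]_(joint w k.+1)) :
  psd r -> psd (check (psi eps x s) r).
Proof. exact: psd_apply_op. Qed.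

Lemma tr_check w k x s (r : 'M[R[i]]_(joint w k.+1)) : psd r ->
  complex.Re (\tr (check (psi eps x s) r)) <= complex.Re (\tr r).
Proof.
move=> hr; apply: (@tr_apply_coisometry _ (w * 3)) => //.
by rewrite trmxCK adjoin_psi_isometry.
Qed.

(** For subnormalised states the trace is the probability of having come so far. The upper bound
    leads to [forcing_probability_le1]; the lower one allows losing branches to be discarded. *)
Lemma run_reveal_bounds p x y v s i w (S : reveal_strategy R p i w) r :
  psd r -> 0 <= run_reveal eps x y v s S r <= complex.Re (\tr r).
Proof.
elim: i w S r => [|i IH] w /=.
  by move=> _ r hr; case: ifP; rewrite ?lexx psd_tr_ge0.
case: (sends p i.+1) => [[w' [E S]] r hr|S r hr]; last exact: IH.
have hrt t := psd_apply_instrument (k := (held p i).+1) E t hr.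
apply/andP; split.
  by apply: sumr_ge0 => t _; case/andP: (IH _ (S t) _ (psd_check y t (hrt t))).
rewrite -(tr_apply_instrument (k := (held p i).+1) E r) raddf_sum /=.
apply: ler_sum => t _.
case/andP: (IH _ (S t) _ (psd_check y t (hrt t))) => _ h.
exact: le_trans h (tr_check y t (hrt t)).
Qed.

Lemma run_announce_bounds p x v s n w (S : announce_strategy R p n w) r :
  psd r -> 0 <= run_announce eps x v s S r <= complex.Re (\tr r).
Proof.
have main w' (E : instrument R bool w w')
    (S' : bool -> reveal_strategy R p n w') (r' : 'M_(joint w (held p n))) :
    psd r' -> 0 <= \sum_(y : bool)
      run_reveal eps x y v s (S' y) (apply_instrument E y r')
      <= complex.Re (\tr r').
  move=> hr; apply/andP; split.
    by apply: sumr_ge0 => y _;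
      case/andP: (run_reveal_bounds x y v s (S' y) (psd_apply_instrument E y hr)).
  rewrite -(tr_apply_instrument E r') raddf_sum /=; apply: ler_sum => y _.
  by case/andP: (run_reveal_bounds x y v s (S' y) (psd_apply_instrument E y hr)).
move: S r; rewrite /announce_strategy /run_announce.
case: (sends p n.+1) => [[w' [E S']] r hr|S r hr].
  exact: (main _ E (fun y => S' y x)).
by case: (S x) => w' [E S']; apply: main.
Qed.

(* One round of [run_commit], with [sends p i.+1] generalised to a variable   *)
(* so that it can be analysed by cases.                                       *)
Definition commit_round p x (s : seq bool) m i w (b : bool)
    (r : 'M[R[i]]_(joint w (held p i))) :
  (if b then {w' : nat & (instrument R unit w (w' * 3) *
                          commit_strategy R p m i.+1 w')%type}
   else commit_strategy R p m i.+1 (w * 3)) ->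
  (forall w' : nat, commit_strategy R p m i.+1 w' ->
     'M[R[i]]_(joint w' (if b then (held p i).+1 else held p i)) -> R) -> R :=
  match b with
  | true => fun S run =>
      let: existT w' (E, S') := S in run w' S' (apply_instrument E tt r)
  | false => fun S run =>
      run (w * 3)%N S (receive (psi eps x (nth false s i)) r)
  end.

Lemma commit_round_bounds p x s m i w b r S run :
  (forall w' S' r', psd r' -> 0 <= run w' S' r' <= complex.Re (\tr r')) ->
  psd r -> 0 <= @commit_round p x s m i w b r S run <= complex.Re (\tr r).
Proof.
case: b S run => /= S run hrun hr; last first.
  rewrite -(tr_apply_isometry r (adjoin_psi_isometry w x (nth false s i))).
  exact/hrun/psd_receive.
case: S => w' [E S]; have := hrun _ S _ (psd_apply_instrument E tt hr).
suff -> : \tr r = \tr (apply_instrument E tt r) by [].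
by rewrite -(tr_apply_instrument E r) (big_pred1 tt) // => -[].
Qed.

Lemma run_commitS p x v s m i w (S : commit_strategy R p m.+1 i w) r :
  run_commit eps x v s S r =
  @commit_round p x s m i w (sends p i.+1) r S
    (fun w' S' r' => run_commit (i := i.+1) eps x v s S' r').
Proof. by []. Qed.

Lemma run_commit_bounds p x v s m i w (S : commit_strategy R p m i w) r :
  psd r -> 0 <= run_commit eps x v s S r <= complex.Re (\tr r).
Proof.
elim: m i w S r => [|m IH] i w; first exact: run_announce_bounds.
move=> S r; rewrite run_commitS; apply: commit_round_bounds.
by move=> *; apply: (IH i.+1).
Qed.

(** This bounds the set whose supremum is [max_forcing], and makes the set whose infimum is [bias]
    nonempty. *)
Lemma forcing_probability_le1 p n (S : strategy R p n) v :
  forcing_probability eps S v <= 1.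
Proof.
have h x s : run_commit eps x v s S (1%:M : 'M_(joint 1 0)) <= 1.
  have := run_commit_bounds x v s S (r := 1%:M).
  rewrite mxtrace1 => /(_ _)/andP[|_ ->//].
  by exists 1%N, 1%:M; rewrite adjmx1 mulmx1.
rewrite /forcing_probability big_bool /=.
have hs (x : bool) : (2 ^+ n)^-1 * (\sum_(s : n.-tuple bool)
    run_commit eps x v s S (1%:M : 'M_(joint 1 0))) <= 1 :> R.
  rewrite ler_pdivrMl ?exprn_gt0 // mulr1.
  apply: (@le_trans _ _ (\sum_(s : n.-tuple bool) 1)).
    by apply: ler_sum => s _; apply: h.
  by rewrite sumr_const card_tuple card_bool natrX.
have := hs true; have := hs false; lra.
Qed.

End Upper.

(** * The cheating strategy: memory, amplitudes and commit phase *)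

Section Cheating.
Context {R : realType}.
Variables (eps : R) (heps : 0 <= eps <= 1) (p : player) (n : nat).

Definition turn i : R := if sends p i then 2^-1 else 1.

Variable W : nat -> R.
Hypothesis W_gt0 : forall i, 0 < W i.
Hypothesis W_last : W n = turn n.+1.
Hypothesis W_step : forall i, (i < n)%N ->
  W i = eps * turn i.+1 + (1 - eps) * W i.+1.

Local Notation sq := (Num.sqrt (1 - eps)).
Local Notation se := (Num.sqrt eps).
Local Notation sW := (fun i => Num.sqrt (W i)).

Fixpoint memdim i : nat := if i is i'.+1 then memdim i' * 3 else 1.

Lemma memdim_gt0 i : (0 < memdim i)%N.
Proof. by elim: i => //= i IH; rewrite muln_gt0 IH. Qed.

(* The memory holds one qutrit per round, received or copied from the one     *)
(* sent; [None] means undecided.                                              *)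
Fixpoint guess i : 'I_(memdim i) -> option bool :=
  match i with
  | 0 => fun _ => None
  | i'.+1 => fun u =>
      let m := @mxtens_unindex (memdim i') 3 u in
      if guess m.1 is Some b then Some b
      else if m.2 == 0 then None else Some (m.2 == inord 2)
  end.

Lemma guessS i (m : 'I_(memdim i)) (j : 'I_3) :
  @guess i.+1 (mxtens_index (m, j)) =
  if guess m is Some b then Some b
  else if j == 0 then None else Some (j == inord 2).
Proof.
pose F (u : 'I_(memdim i) * 'I_3) := if guess u.1 is Some b then Some b
  else if u.2 == 0 then None else Some (u.2 == inord 2).
by rewrite -[RHS]/(F (m, j)) -[in RHS](mxtens_indexK (m, j)).
Qed.

(** The undecided amplitudes are the unit vector, symmetric in the two guesses, that maximises the
    weight recovered when the round is undone. By Cauchy-Schwarz it is proportional to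
    [sq * sW i.+1], [se / 2], [se / 2]. *)
Definition send_coef i (m : 'I_(memdim i)) (j : 'I_3) : R :=
  if guess m is Some b then psi_coef eps b false j
  else if j == 0 then sq * sW i.+1 / sW i else se / (2 * sW i).

(** The right factor prepares a qutrit in memory; the left one copies its basis state into the
    qutrit to be sent. *)
Definition send_iso i : 'M[R[i]]_(memdim i * 3 * 3, memdim i) :=
  colop (fun u j => ((@mxtens_unindex (memdim i) 3 u).2 == j)%:R)
  *m colop (@send_coef i).

(* In the reveal phase, once the rounds after i are undone, the winning part  *)
(* of the state is [diagop (rho x)] applied to the state after i rounds of    *)
(* the commit phase.                                                          *)
Definition rho x i (m : 'I_(memdim i)) : R :=
  if guess m is Some b then (b == x)%:R else sW i.

Definition commit_vec x (s : seq bool) i (b : bool)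
    (f : 'cV[R[i]]_(joint (memdim i) (held p i))) :
  'cV[R[i]]_(joint (memdim i * 3) (if b then (held p i).+1 else held p i)) :=
  match b with
  | true => lift_op (held p i) (send_iso i) *m f
  | false =>
      lift_op (held p i) (adjoin (memdim i) (psi eps x (nth false s i))) *m f
  end.

Fixpoint commit_state x (s : seq bool) i :
    'cV[R[i]]_(joint (memdim i) (held p i)) :=
  match i return 'cV[R[i]]_(joint (memdim i) (held p i)) with
  | 0 => 1%:M
  | i'.+1 => commit_vec x s (sends p i'.+1) (commit_state x s i')
  end.

Let a2 : sq * sq = 1 - eps.
Proof. by rewrite -expr2 sqr_sqrtr // subr_ge0; case/andP: heps. Qed.

Let e2 : se * se = eps.
Proof. by rewrite -expr2 sqr_sqrtr //; case/andP: heps. Qed.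

Let u2 i : sW i * sW i = W i.
Proof. by rewrite -expr2 sqr_sqrtr // ltW. Qed.

Let sW_neq0 i : sW i != 0.
Proof. by rewrite gt_eqF // sqrtr_gt0. Qed.

Lemma W_send i : (i < n)%N -> sends p i.+1 ->
  sq * sq * (sW i.+1 * sW i.+1) + se * se / 2 = sW i * sW i.
Proof.
by move=> lin hi; rewrite a2 !u2 e2 (W_step lin) /turn hi addrC.
Qed.

Lemma W_recv i : (i < n)%N -> ~~ sends p i.+1 ->
  sq * sq * (sW i.+1 * sW i.+1) + se * se = sW i * sW i.
Proof.
by move=> lin /negbTE hi; rewrite a2 !u2 e2 (W_step lin) /turn hi mulr1 addrC.
Qed.

Let sumI3E := (inord3_neq0, inord3_eq, eqxx).

Lemma sum_send_coef i (m : 'I_(memdim i)) : (i < n)%N -> sends p i.+1 ->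
  \sum_j send_coef m j * send_coef m j = 1.
Proof.
move=> lin hi; rewrite /send_coef; case: (guess m) => [b|].
  exact: sum_psi_coef.
have h := W_send lin hi; have v0 := sW_neq0 i.
rewrite (sum_I3 _ true) !sumI3E.
transitivity ((sq * sq * (sW i.+1 * sW i.+1) + se * se / 2) / (sW i * sW i)).
  by field.
by rewrite h divff // mulf_neq0.
Qed.

Lemma send_iso_isometry i : (i < n)%N -> sends p i.+1 ->
  (send_iso i) ^t* *m send_iso i = 1%:M.
Proof.
move=> lin hi; rewrite /send_iso adjmxM !colop_adj mulmxA -(mulmxA (rowop _)).
rewrite mul_rowop_colop [diagop _]diagop1 ?mulmx1; last first.
  move=> u; rewrite (bigD1 (@mxtens_unindex (memdim i) 3 u).2) //= eqxx mulr1.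
  by rewrite big1 ?addr0 // => j hj; rewrite eq_sym (negbTE hj) mulr0.
by rewrite mul_rowop_colop diagop1 // => m; apply: sum_send_coef.
Qed.

(** * Undoing a round in which the cheater sent *)

Definition reveal_coef (y t : bool) (j : 'I_3) : R :=
  ((j == 0)%:R + (j == inord y.+1)%:R * (-1) ^+ t) / Num.sqrt 2.

(** Measuring the kept copy with outcome [t] puts the phase [(-1) ^+ t] on the sent qutrit. A branch
    decided on [y] thus steers it to [psi eps y t], with [t] uniform as for an honest sender. *)
Definition reveal_meas w (y t : bool) : 'M[R[i]]_(w, w * 3) :=
  rowop (fun _ => reveal_coef y t).

Let sqrt2_neq0 : Num.sqrt 2 != 0 :> R.
Proof. by rewrite gt_eqF // sqrtr_gt0. Qed.

Lemma I3_cases (y : bool) (j : 'I_3) :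
  [\/ j = 0, j = inord y.+1 | j = inord (~~ y).+1].
Proof.
case: j => -[|[|[|//]]] h; first by constructor 1; apply/val_inj.
  by case: y; [constructor 3|constructor 2]; apply/val_inj; rewrite /= inordK.
by case: y; [constructor 2|constructor 3]; apply/val_inj; rewrite /= inordK.
Qed.

Lemma negb_eq (y : bool) : ((~~ y == y) = false) * ((y == ~~ y) = false).
Proof. by case: y. Qed.

Lemma reveal_meas_complete w y :
  \sum_t (reveal_meas w y t) ^t* *m reveal_meas w y t
  + (rowop (fun (_ : 'I_w) j => (j == inord (~~ y).+1)%:R)) ^t*
    *m rowop (fun (_ : 'I_w) j => (j == inord (~~ y).+1)%:R) = 1%:M :> 'M[R[i]]_(w * 3).
Proof.
have h2 : Num.sqrt 2 * Num.sqrt 2 = 2 :> R by rewrite -expr2 sqr_sqrtr.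
rewrite big_bool /reveal_meas !rowop_adj.
apply/matrixP => u v; case: (mxtens_indexP u) => a b.
case: (mxtens_indexP v) => a' b'.
rewrite [LHS]mxE [X in X + _]mxE !mul_colop_rowop !mxE.
rewrite (can_eq (@mxtens_indexK _ _)) xpair_eqE -!rmorphD -!mulrDr.
rewrite -mulnb natrM.
transitivity (((a == a')%:R * (b == b')%:R : R)%:C); last first.
  by rewrite rmorphM !rmorph_nat.
congr (_ * _)%:C; rewrite /reveal_coef expr1 expr0.
have : (Num.sqrt 2)^-1 * (Num.sqrt 2)^-1 = 2^-1 :> R by rewrite -invfM h2.
move: (_^-1) => c hc.
by case: (I3_cases y b) => ->; case: (I3_cases y b') => ->;
  rewrite ?sumI3E ?(eq_sym 0) ?sumI3E ?negb_eq /=; lra.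
Qed.

Lemma sum_reveal_send x i t (m : 'I_(memdim i)) : (i < n)%N -> sends p i.+1 ->
  \sum_j reveal_coef x t j * (psi_coef eps x t j
    * @rho x i.+1 (mxtens_index (m, j)) * send_coef m j)
  = (Num.sqrt 2)^-1 * rho x m.
Proof.
move=> lin hi; rewrite (sum_I3 _ x) /rho !guessS /send_coef /reveal_coef.
case: (guess m) => [b|].
  case: (eqVneq b x) => [->|_]; last by rewrite !(mulr0, mul0r) !addr0.
  rewrite /psi_coef ?sumI3E ?(eq_sym 0) ?sumI3E ?negb_eq /= expr0.
  rewrite !(mulr1, mul1r, mul0r, addr0, add0r, mulr0).
  transitivity ((Num.sqrt 2)^-1 * (sq * sq + se * se)).
    by case: t; rewrite ?expr1 ?expr0; field.
  by rewrite a2 e2 subrK mulr1.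
have h := W_send lin hi; have v0 := sW_neq0 i.
rewrite /psi_coef ?sumI3E ?(eq_sym 0) ?sumI3E ?negb_eq /=.
have -> : (inord x.+1 == inord 2 :> 'I_3) = x.
  by rewrite -val_eqE /= !inordK //; case: x.
rewrite eqxx !(mulr1, mul1r, mul0r, addr0, add0r, mulr0).
transitivity ((Num.sqrt 2)^-1 *
   ((sq * sq * (sW i.+1 * sW i.+1) + se * se / 2) / sW i)).
  by case: t; rewrite ?expr1 ?expr0; field; rewrite ?v0 ?sqrt2_neq0.
by rewrite h mulfK.
Qed.

(** The sign in [reveal_coef] cancels the sign in [psi], so the result is the same for both [t]. The
    factor is the amplitude of a uniform bit. *)
Lemma reveal_meas_send x i t : (i < n)%N -> sends p i.+1 ->
  reveal_meas (memdim i) x t *m (adjoin (memdim i * 3) (psi eps x t)) ^t*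
    *m tensmx (diagop (@rho x i.+1)) 1%:M *m send_iso i
  = ((Num.sqrt 2)^-1)%:C *: diagop (@rho x i).
Proof.
move=> lin hi; rewrite psiE adjoin_colop colop_adj tens_diagop /send_iso.
rewrite -!mulmxA (mulmxA (diagop _)) mul_diagop_colop (mulmxA (rowop _)).
rewrite mul_rowop_colop mul_diagop_colop mul_rowop_colop.
apply/matrixP => a b; rewrite !mxE -rmorphM mulrCA; congr (_ * _)%:C.
rewrite -(sum_reveal_send x t a lin hi); apply: eq_bigr => j _.
under eq_bigr => k _ do rewrite !mxtens_indexK.
rewrite (bigD1 j) //= big1 ?addr0 ?eqxx ?mulr1 // => k hk.
by rewrite eq_sym (negbTE hk) !mulr0.
Qed.

(** * Undoing a round in which the cheater received *)

Definition recv_coef y s i (m : 'I_(memdim i)) (j : 'I_3) : R :=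
  if guess m is Some _ then psi_coef eps y s j
  else (j == 0)%:R * (sq * sW i.+1 / sW i)
       + (j == inord y.+1)%:R * ((-1) ^+ s * se / sW i).

Lemma sum_recv_coef y s i (m : 'I_(memdim i)) : (i < n)%N -> ~~ sends p i.+1 ->
  \sum_j recv_coef y s m j * recv_coef y s m j = 1.
Proof.
move=> lin hi; rewrite /recv_coef; case: (guess m) => [b|].
  exact: sum_psi_coef.
have h := W_recv lin hi; have v0 := sW_neq0 i.
rewrite (sum_I3 _ y) ?sumI3E ?(eq_sym 0) ?sumI3E ?negb_eq /=.
rewrite !(mulr1, mul1r, mul0r, addr0, add0r, mulr0).
transitivity ((sq * sq * (sW i.+1 * sW i.+1) + se * se) / (sW i * sW i)).
  by case: s; rewrite ?expr1 ?expr0; field.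
by rewrite h divff // mulf_neq0.
Qed.

(** For undecided [m], [recv_coef] is the normalised vector of the products on its right, so the
    overlap is the norm of that vector. For decided [m], [rho] does not depend on [j] and factors
    out. *)
Lemma sum_reveal_recv y s i (m : 'I_(memdim i)) : (i < n)%N -> ~~ sends p i.+1 ->
  \sum_j recv_coef y s m j *
    (@rho y i.+1 (mxtens_index (m, j)) * psi_coef eps y s j) = rho y m.
Proof.
move=> lin hi; rewrite /rho /recv_coef; case E: (guess m) => [b|].
  under eq_bigr => j _ do rewrite guessS E mulrCA.
  by rewrite -mulr_sumr sum_psi_coef // mulr1.
have h := W_recv lin hi; have v0 := sW_neq0 i.
rewrite (sum_I3 _ y) !guessS E /psi_coef ?sumI3E ?(eq_sym 0) ?sumI3E ?negb_eq /=.
have -> : (inord y.+1 == inord 2 :> 'I_3) = y.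
  by rewrite -val_eqE /= !inordK //; case: y.
rewrite eqxx !(mulr1, mul1r, mul0r, addr0, add0r, mulr0).
transitivity ((sq * sq * (sW i.+1 * sW i.+1) + se * se) / sW i).
  by case: s; rewrite ?expr1 ?expr0; field.
by rewrite h mulfK.
Qed.

Lemma rowop_recv_coisometry y s i : (i < n)%N -> ~~ sends p i.+1 ->
  rowop (@recv_coef y s i) *m (rowop (@recv_coef y s i)) ^t* = 1%:M.
Proof.
move=> lin hi; rewrite rowop_adj mul_rowop_colop diagop1 // => m.
exact: sum_recv_coef.
Qed.

Lemma reveal_recv y s i : (i < n)%N -> ~~ sends p i.+1 ->
  rowop (@recv_coef y s i) *m diagop (@rho y i.+1)
    *m adjoin (memdim i) (psi eps y s) = diagop (@rho y i).
Proof.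
move=> lin hi; rewrite psiE adjoin_colop -mulmxA mul_diagop_colop.
rewrite mul_rowop_colop; apply/matrixP => a b; rewrite !mxE.
by rewrite -(sum_reveal_recv _ s a lin hi).
Qed.

(** * The reveal phase *)

Lemma check_reveal w wa k y t (K : 'M[R[i]]_(w, w * 3))
    (Z : 'M_(w * 3, wa)) (f : 'cV_(joint wa k.+1)) :
  lift_op k ((adjoin w (psi eps y t)) ^t*) *m (lift_op k.+1 (K *m Z) *m f)
  = lift_op k (K *m (adjoin (w * 3) (psi eps y t)) ^t*) *m (lift_op k.+1 Z *m f).
Proof.
rewrite lift_opM !mulmxA; congr (_ *m _ *m _).
rewrite /= -!lift_opM; congr lift_op.
have := congr1 (fun X => X ^t*) (mulmx_tens_adjoin (K ^t*) (psi eps y t)).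
by rewrite !adjmxM adjmx_tens trmxCK adjmx1 => ->.
Qed.

(* A strategy cannot act upon receiving a bit: the operation to be performed  *)
(* is left pending, as the coisometry [Z], until the next message is sent.    *)
Lemma reveal_strategy_exists (x : bool) i wa (Z : 'M[R[i]]_(memdim i, wa)) :
  (i <= n)%N -> Z *m Z ^t* = 1%:M ->
  exists S : reveal_strategy R p i wa, forall s c f r, dominates r f ->
    lift_op (held p i) Z *m f
      = c%:C *: (lift_op (held p i) (diagop (@rho x i)) *m commit_state x s i) ->
    c ^+ 2 * W 0 <= run_reveal eps x x false s S r.
Proof.
elim: i wa Z => [|i IH] wa Z lin hZ.
  exists tt => s c f r hr hf; rewrite /= addbb eqxx.
  (* The trace of [r] is at least the squared norm of [f], which the coisometry [Z] can only
     decrease; [Z *m f] has squared norm [c ^+ 2 * W 0]. *)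
  have /psd_tr_ge0 := hr; rewrite !raddfB /= subr_ge0; apply: le_trans.
  have := tr_apply_coisometry (k := 0) hZ (psd_outer f); apply: le_trans.
  have -> : apply_op (lift_op 0 Z) (f *m f ^t*) = (Z *m f) *m (Z *m f) ^t*.
    by rewrite /apply_op adjmxM !mulmxA.
  move: hf => /= ->; rewrite mulmx1 adjmxZ conjC_real -scalemxAl -scalemxAr.
  rewrite diagop_adj mul_diagop !mxtraceZ.
  rewrite /mxtrace big_ord1 mxE eqxx mul1r /rho /= u2.
  by rewrite !mul0r !subr0 mulrA -expr2.
have IH1 := IH (memdim i) 1%:M (ltnW lin).
have IH2 b := IH wa (rowop (@recv_coef x b i) *m Z) (ltnW lin).
have hsend t := @reveal_meas_send x i t lin.
have hrecv b := @reveal_recv x b i lin.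
have hco b := @rowop_recv_coisometry x b i lin.
move: hsend hrecv hco => /=.
case: (sends p i.+1) => /= hsend hrecv hco; last first.
  have hco' b : rowop (@recv_coef x b i) *m Z *m
      (rowop (@recv_coef x b i) *m Z) ^t* = 1%:M.
    by rewrite adjmxM mulmxA -(mulmxA _ Z) hZ mulmx1 hco.
  have [St hSt] := IH2 true (hco' true); have [Sf hSf] := IH2 false (hco' false).
  exists (fun b : bool => if b then St else Sf) => s c f r hr hf.
  (* Learning [s_i] only composes the pending coisometry with the matching bra. *)
  have key : lift_op (held p i) (rowop (@recv_coef x (nth false s i) i) *m Z)
      *m f = c%:C *: (lift_op (held p i) (diagop (@rho x i))
                      *m commit_state x s i).
    rewrite lift_opM -mulmxA hf -scalemxAr; congr (_ *: _).
    by rewrite !mulmxA -!lift_opM hrecv.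
  by move: key; case: (nth false s i) => key; [apply: hSt key|apply: hSf key].
have [S hS] := IH1 (etrans (mul1mx _) (adjmx1 _)).
pose Q := rowop (fun (_ : 'I_(memdim i)) j => (j == inord (~~ x).+1)%:R : R).
have hQ := reveal_meas_complete (memdim i) x; rewrite -/Q in hQ.
(* The pending [Z] is now carried out together with the measurement. The unwanted operators are the
   projector onto the kernel of [Z] and the third outcome [Q], where the copy shows the wrong
   bit. *)
have hE : \sum_t (reveal_meas (memdim i) x t *m Z) ^t*
      *m (reveal_meas (memdim i) x t *m Z)
    + (col_mx (1%:M - Z ^t* *m Z) (Q *m Z)) ^t*
      *m col_mx (1%:M - Z ^t* *m Z) (Q *m Z) = 1%:M.
  rewrite tr_col_mx map_row_mx mul_row_col coisometry_complement //.
  have tele (A : 'M_(memdim i, memdim i * 3)) :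
      (A *m Z) ^t* *m (A *m Z) = Z ^t* *m (A ^t* *m A) *m Z.
    by rewrite adjmxM !mulmxA.
  under eq_bigr => t _ do rewrite tele.
  rewrite tele -mulmx_suml -mulmx_sumr addrCA -mulmxDl -mulmxDr hQ.
  by rewrite mulmx1 subrK.
have [E hEt] := instrument_completion true (memdim_gt0 i) hE.
exists (existT _ (memdim i) (E, fun _ => S)) => s c f r hr hf.
(* Either [t] leaves [c / Num.sqrt 2] times the target vector, with nothing pending; the two
   contributions add up to [c ^+ 2 * W 0]. *)
have hb t : (c / Num.sqrt 2) ^+ 2 * W 0 <= run_reveal eps x x false s S
    (check (psi eps x t) (apply_instrument (k := (held p i).+1) E t r)).
  have [j hj] := hEt t.
  have := dominates_apply_instrument (k := (held p i).+1) t j hr.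
  rewrite hj => /(dominates_apply_op (lift_op (held p i)
    ((adjoin (memdim i) (psi eps x t)) ^t*))) /hS; apply.
  rewrite lift_op1 mul1mx check_reveal [lift_op _.+1 Z *m f]hf.
  rewrite -scalemxAr rmorphM -scalerA; congr (_ *: _).
  rewrite !mulmxA /= -!lift_opM hsend // linearZ /= -scalemxAl.
  by [].
rewrite big_bool; apply: le_trans (lerD (hb true) (hb false)).
have h2 : Num.sqrt 2 * Num.sqrt 2 = 2 :> R by rewrite -expr2 sqr_sqrtr.
rewrite exprMn exprVn [Num.sqrt 2 ^+ 2]expr2 h2; lra.
Qed.

(** * The announcement, and assembly of the strategy *)

Definition announce_coef (x : option bool) y (m : 'I_(memdim n)) : R :=
  if guess m is Some b then (b == y)%:R
  else if x is Some x' then (x' == y)%:R else (Num.sqrt 2)^-1.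

Lemma announce_complete x :
  \sum_(y : bool) \sum_(j < 1)
    (diagop (@announce_coef x y)) ^t* *m diagop (@announce_coef x y) = 1%:M.
Proof.
have h2 : (Num.sqrt 2)^-1 * (Num.sqrt 2)^-1 = 2^-1 :> R.
  by rewrite -invfM -expr2 sqr_sqrtr.
rewrite big_bool /= !big_ord1 !diagop_adj !mul_diagop diagopD diagop1 // => m.
rewrite /announce_coef; case: (guess m) => [[]|] /=; try lra.
by case: x => [[]|] /=; lra.
Qed.

Definition announce_instrument x : instrument R bool (memdim n) (memdim n) :=
  Instrument (announce_complete x).

(** An undecided cheater copies an already known honest bit, or else announces a uniform bit with
    amplitude the inverse square root of 2. In both cases the amplitude is the square root of
    [W n]. *)
Lemma announce_coefE x :
  @announce_coef (if sends p n.+1 then None else Some x) x = @rho x n.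
Proof.
apply: funext => m; rewrite /announce_coef /rho W_last /turn.
case: (guess m) => // ; case: (sends p n.+1); last by rewrite eqxx sqrtr1.
by rewrite sqrtrV.
Qed.

Lemma announce_strategy_exists :
  exists S : announce_strategy R p n (memdim n), forall x s r,
    dominates r (commit_state x s n) -> W 0 <= run_announce eps x false s S r.
Proof.
have reveal x := reveal_strategy_exists x (leqnn n)
  (etrans (mul1mx _) (adjmx1 (memdim n))).
have [St hSt] := reveal true; have [Sf hSf] := reveal false.
pose S (b : bool) := if b then St else Sf.
have main x s r : dominates r (commit_state x s n) ->
    W 0 <= \sum_(y : bool) run_reveal eps x y false s (S y)
      (apply_instrument
        (announce_instrument (if sends p n.+1 then None else Some x)) y r).
  (* Only the announcement [y = x] gives [c = 0]; the other term is merely nonnegative. *)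
  move=> hr; rewrite (bigD1 x) //= -[leLHS]addr0; apply: lerD; last first.
    apply: sumr_ge0 => y _; have /(psd_apply_instrument (announce_instrument
      (if sends p n.+1 then None else Some x)) y) := dominates_psd hr.
    by move=> /(run_reveal_bounds heps x y false s (S y))/andP[].
  have hd := dominates_apply_instrument
    (E := announce_instrument (if sends p n.+1 then None else Some x)) x 0 hr.
  rewrite -[W 0]mul1r -[X in X * _](expr1n _ 2).
  have key : lift_op (held p n) 1%:M
     *m (lift_op (held p n) (diagop (@announce_coef
          (if sends p n.+1 then None else Some x) x)) *m commit_state x s n)
     = 1%:C *: (lift_op (held p n) (diagop (@rho x n)) *m commit_state x s n).
    by rewrite lift_op1 mul1mx scale1r announce_coefE.
  by case: (x) hd key => hd key; [apply: hSt hd key | apply: hSf hd key].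
move: main; rewrite /announce_strategy /run_announce.
case: (sends p n.+1) => main.
  by exists (existT _ (memdim n) (announce_instrument None, fun y _ => S y)).
by exists (fun x => existT _ (memdim n) (announce_instrument (Some x), S)).
Qed.

(** The type of a round depends on [sends p i.+1], so this boolean is a variable [b] here. [S] is
    chosen before [x] and [s], which the cheater does not know. *)
Lemma commit_round_exists m i b (S' : commit_strategy R p m i.+1 (memdim i * 3)) :
  (i < n)%N -> sends p i.+1 = b ->
  exists S : if b then {w' : nat & (instrument R unit (memdim i) (w' * 3) *
                                    commit_strategy R p m i.+1 w')%type}
             else commit_strategy R p m i.+1 (memdim i * 3),
    forall x s r f (run : forall w', commit_strategy R p m i.+1 w' ->
        'M_(joint w' (if b then (held p i).+1 else held p i)) -> R),
      dominates r f ->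
      (forall r', dominates r' (commit_vec x s b f) ->
         W 0 <= run (memdim i * 3)%N S' r') ->
      W 0 <= @commit_round _ eps p x s m i (memdim i) b r S run.
Proof.
case: b => lin hi.
  have hK : \sum_(t : unit) \sum_(j < 1) (send_iso i) ^t* *m send_iso i = 1%:M.
    by rewrite (big_pred1 tt) ?big_ord1 ?send_iso_isometry // => -[].
  exists (existT _ (memdim i * 3)%N (Instrument hK, S')) => x s r f run hr hrun /=.
  by apply: hrun; apply: (dominates_apply_instrument (E := Instrument hK) tt 0 hr).
exists S' => x s r f run hr hrun /=.
by apply: hrun; apply: dominates_apply_op.
Qed.

Lemma commit_strategy_exists m i : (i + m = n)%N ->
  exists S : commit_strategy R p m i (memdim i), forall x s r,
    dominates r (commit_state x s i) -> W 0 <= run_commit eps x false s S r.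
Proof.
elim: m i => [|m IH] i.
  by rewrite addn0 => ->; apply: announce_strategy_exists.
move=> him; have [|S' hS'] := IH i.+1; first by rewrite addSnnS.
have lin : (i < n)%N by rewrite -him -addSnnS leq_addr.
have [S hS] := commit_round_exists S' lin erefl.
exists S => x s r hr; rewrite run_commitS; apply: hS hr _ => r' hr'.
exact: hS'.
Qed.

Lemma forcing_probability_ge :
  exists S : strategy R p n, W 0 <= forcing_probability eps S false.
Proof.
have [S hS] := commit_strategy_exists (add0n n).
exists S; rewrite /forcing_probability big_bool /=.
have hx (x : bool) : W 0 <= (2 ^+ n)^-1 * \sum_(s : n.-tuple bool)
    run_commit eps x false s S (1%:M : 'M_(joint 1 0)).
  rewrite ler_pdivlMl ?exprn_gt0 //.
  have -> : 2 ^+ n * W 0 = \sum_(s : n.-tuple bool) W 0.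
    by rewrite sumr_const card_tuple card_bool -[RHS]mulr_natl natrX.
  apply: ler_sum => s _; apply: hS.
  by have := dominates_outer (commit_state x s 0); rewrite /= mul1mx adjmx1.
have := hx true; have := hx false; lra.
Qed.

End Cheating.

(** * Solving the recurrence, and the bias *)

Fixpoint value {R : realType} (eps : R) p m i : R :=
  if m is m'.+1 then eps * turn p i.+1 + (1 - eps) * value eps p m' i.+1
  else turn p i.+1.

Section Value.
Context {R : realType}.
Variables (eps : R) (heps : 0 <= eps <= 1).

Lemma value_gt0 p m i : 0 < value eps p m i.
Proof.
suff : 2^-1 <= value eps p m i by apply: lt_le_trans; rewrite invr_gt0.
have ht k : 2^-1 <= turn p k :> R by rewrite /turn; case: ifP => _; lra.
elim: m i => [|m IH] i /=; first exact: ht.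
have [h0 h1] := andP heps.
have := ler_wpM2l h0 (ht i.+1).
have h2 : 0 <= 1 - eps by lra.
have := ler_wpM2l h2 (IH i.+1); lra.
Qed.

Lemma max_forcing_ge p n (S : strategy R p n) v :
  forcing_probability eps S v <= max_forcing p n eps.
Proof.
apply: ub_le_sup; last by exists S, v.
by exists 1 => _ [S' [v' ->]]; apply: forcing_probability_le1.
Qed.

Lemma strategy_value p n : exists S : strategy R p n,
  value eps p n 0 <= forcing_probability eps S false.
Proof.
(* [W] runs upwards to [n], whereas [value] recurses on the number [n - i] of rounds left. *)
have [|||S hS] := @forcing_probability_ge R eps heps p n
  (fun i => value eps p (n - i) i).
- by move=> i; apply: value_gt0.
- by rewrite subnn.
- by move=> i hi; rewrite -subSS subSn.
by exists S; rewrite subn0 in hS.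
Qed.

Lemma max_forcing_value p n : value eps p n 0 <= max_forcing p n eps.
Proof.
by have [S /le_trans] := strategy_value p n; apply; apply: max_forcing_ge.
Qed.

(** [turn] is 3/4 plus or minus 1/4 with signs alternating over the rounds, so the signed deviation
    [d] of [value] from 3/4 obeys [d' = eps / 4 - (1 - eps) * d] with [d = 1 / 4] initially. Its
    fixed point is [eps / (4 * (2 - eps))]. *)
Lemma valueE p m i : (2 - eps) * value eps p m i =
  (2 - eps) * (3 / 4) + (-1) ^+ sends p i.+1 *
    (eps / 4 + (- (1 - eps)) ^+ m * ((1 - eps) / 2)).
Proof.
elim: m i => [|m IH] i /=.
  by rewrite /turn; case: (sends p i.+1); rewrite ?expr1 !expr0; lra.
rewrite mulrDr (mulrCA _ (1 - eps)) IH exprS /turn.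
have -> : sends p i.+2 = ~~ sends p i.+1 by case: p {IH} => /=; rewrite ?negbK.
move: (_ ^+ m) => z.
by case: (sends p i.+1); rewrite ?expr1 ?expr0 /=; lra.
Qed.

Lemma value_closed p n : value eps p n 0 =
  (2 * (2 - eps))^-1 * (3 * (2 - eps) / 2 + (-1) ^+ sends p 1 *
    (eps / 2 + (-1) ^+ n * (1 - eps) ^+ n.+1)).
Proof.
have h : 2 - eps != 0 by apply: lt0r_neq0; case/andP: heps => _ h; lra.
apply: (mulfI h); rewrite valueE (exprNn (1 - eps)) exprS.
move: (_ ^+ sends p 1) ((-1) ^+ n) ((1 - eps) ^+ n) => a y z; field.
by rewrite h.
Qed.

Lemma max_forcing_sum n : 3 / 2 <= max_forcing Alice n eps + max_forcing Bob n eps.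
Proof.
apply: le_trans (lerD (max_forcing_value Alice n) (max_forcing_value Bob n)).
have h : 2 - eps != 0 by apply: lt0r_neq0; case/andP: heps => _ h; lra.
rewrite !value_closed /= expr1 expr0.
rewrite le_eqVlt; apply/orP; left; apply/eqP; field.
by rewrite h.
Qed.

Lemma max_forcing_le p n delta :
  (forall (S : strategy R p n) v, forcing_probability eps S v <= 2^-1 + delta) ->
  max_forcing p n eps <= 2^-1 + delta.
Proof.
have [S _] := strategy_value p n.
move=> h; apply: ge_sup => [|_ [S' [v ->]]//].
by exists (forcing_probability eps S false), S, false.
Qed.

Lemma bias_ge n : 1 / 4 <= bias n eps.
Proof.
apply: lb_le_inf.
  exists 1 => p S v; have := forcing_probability_le1 heps S v; lra.
move=> delta hd; have := max_forcing_sum n.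
have := max_forcing_le (hd Alice); have := max_forcing_le (hd Bob); lra.
Qed.

End Value.

Theorem mainTheorem2 (R : realType) (n : nat) (hn : (1 <= n)%N)
    (eps : R) (heps : 0 <= eps <= 1) :
  (odd n ->
     (2 * (2 - eps))^-1 * (3 - 2 * eps + (1 - eps) ^+ n.+1)
       <= max_forcing Alice n eps) /\
  (~~ odd n ->
     (2 * (2 - eps))^-1 * (3 - 2 * eps - (1 - eps) ^+ n.+1)
       <= max_forcing Alice n eps) /\
  (2 * (2 - eps))^-1 * (3 - eps + (-1) ^+ n * (1 - eps) ^+ n.+1)
    <= max_forcing Bob n eps /\
  3 / 2 <= max_forcing Alice n eps + max_forcing Bob n eps /\
  3 / 4 <= Num.max (max_forcing Alice n eps) (max_forcing Bob n eps) /\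
  1 / 4 <= bias n eps.
Proof.
have hA := max_forcing_value heps Alice n.
have hB := max_forcing_value heps Bob n.
have hAB := max_forcing_sum heps n.
(* Alice sends in round 1, so the sign of the deviation is negative for her and positive for Bob. *)
rewrite !value_closed //= expr1 expr0 in hA hB.
split => [on|]; last split => [en|]; last split.
- apply: le_trans hA; rewrite -signr_odd on expr1 le_eqVlt; apply/orP; left.
  by apply/eqP; congr (_ * _); lra.
- apply: le_trans hA; rewrite -signr_odd (negbTE en) expr0 le_eqVlt.
  by apply/orP; left; apply/eqP; congr (_ * _); lra.
- apply: le_trans hB; rewrite le_eqVlt; apply/orP; left.
  by apply/eqP; congr (_ * _); lra.
split=> //; split; last exact: bias_ge.
by rewrite le_max; case: (lerP (3 / 4) (max_forcing Alice n eps)) => //= h; lra.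
Qed.
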